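(* Let $G$ be a finite group and $n\ge 0$. The Grothendieck ring of submissive $G\wr\Sigma_n$-sets, regarded as a subring of $A(G\wr\Sigma_n)$, is the summand $\mathring{A}(G,n)\subseteq A(G\wr\Sigma_n)$.
   Context: For a finite group $\Gamma$, $A(\Gamma)$ is the Burnside ring: the Grothendieck ring of the semiring $A^+(\Gamma)$ of isomorphism classes $[X]$ of finite $\Gamma$-sets under disjoint union and Cartesian product. Its canonical $\mathbb{Z}$-basis consists of the isomorphism classes of transitive $\Gamma$-sets. $G\wr\Sigma_n=G^{\times n}\rtimes\Sigma_n$ with multiplication $(\bar g,\sigma)(\bar h,\tau)=(\bar g\,\sigma\bar h,\sigma\tau)$, $(\sigma\bar h)_i=\bar h_{\sigma^{-1}(i)}$. If $X$ is a left $G$-set, $G\wr\Sigma_n$ acts on $X^{\times n}$ by $((\bar g,\sigma)x)_i=\bar g_i x_{\sigma^{-1}(i)}$. For $n=i+j$ the transfer product $\star\colon A(G\wr\Sigma_i)\otimes A(G\wr\Sigma_j)\to A(G\wr\Sigma_n)$ is induced by $X\star Y=(G\wr\Sigma_n)\times_{G\wr\Sigma_i\times G\wr\Sigma_j}(X\times Y)$, using a standard embedding $G\wr\Sigma_i\times G\wr\Sigma_j\subseteq G\wr\Sigma_n$. The total power operations $\mathbb{P}_n\colon A(G)\to A(G\wr\Sigma_n)$, $n\ge0$, are the unique functions with $\mathbb{P}_n([X])=[X^{\times n}]$ for finite $G$-sets $X$, $\mathbb{P}_0=1$ constantly, and $\mathbb{P}_n(x+y)=\sum_{i+j=n}\mathbb{P}_i(x)\star\mathbb{P}_j(y)$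 for all $x,y\in A(G)$. $\mathring{A}(G,n)\subseteq A(G\wr\Sigma_n)$ is the additive summand spanned by the smallest subset of the canonical basis of $A(G\wr\Sigma_n)$ whose span contains the image of $\mathbb{P}_n\colon A(G)\to A(G\wr\Sigma_n)$. A finite $G\wr\Sigma_n$-set $X$ is submissive if it admits a $G\wr\Sigma_n$-equivariant injection into $Y^{\times n}$ for some $G$-set $Y$. The Grothendieck ring of submissive $G\wr\Sigma_n$-sets, viewed inside $A(G\wr\Sigma_n)$, is the subring additively generated by the classes of submissive $G\wr\Sigma_n$-sets; as an abelian group it is freely generated by the isomorphism classes of transitive submissive $G\wr\Sigma_n$-sets. *)

(* Defs.v *)
From HB Require Import structures.
From mathcomp Require Import all_boot all_algebra all_fingroup.
From mathcomp Require Import generic_quotient ring.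
From mathcomp Require Import boolp classical_sets.

Set Implicit Arguments.
Unset Strict Implicit.
Unset Printing Implicit Defensive.

Import GRing.Theory.
Local Open Scope ring_scope.
Local Open Scope quotient_scope.

Section GrothendieckRing.
Variable S : comPzSemiRingType.
Implicit Types a b c : S * S.

(* The pair a stands for the formal difference a.1 - a.2. *)
Definition groth_rel a b : bool :=
  `[< exists k : S, a.1 + b.2 + k = b.1 + a.2 + k >].

Lemma groth_relP a b :
  reflect (exists k : S, a.1 + b.2 + k = b.1 + a.2 + k) (groth_rel a b).
Proof. exact: asboolP. Qed.

Fact groth_rel_refl : reflexive groth_rel.
Proof. by move=> a; apply/groth_relP; exists 0. Qed.

Fact groth_rel_sym : symmetric groth_rel.
Proof. by move=> a b; apply/groth_relP/groth_relP => -[k e]; exists k. Qed.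

Fact groth_rel_trans : transitive groth_rel.
Proof.
move=> b a c /groth_relP[k e] /groth_relP[l f].
apply/groth_relP; exists (b.1 + b.2 + k + l).
transitivity ((a.1 + b.2 + k) + (b.1 + c.2 + l)); first ring.
by rewrite e f; ring.
Qed.

Canonical groth_equiv :=
  EquivRel groth_rel groth_rel_refl groth_rel_sym groth_rel_trans.

Definition groth := {eq_quot groth_equiv}.

HB.instance Definition _ := Choice.on groth.
HB.instance Definition _ := Quotient.on groth.

Definition groth_class a : groth := \pi_{eq_quot groth_equiv} a.
Definition groth_repr (x : groth) : S * S := repr (x : {eq_quot groth_equiv}).

Lemma groth_reprK x : groth_class (groth_repr x) = x.
Proof. exact: reprK. Qed.

Lemma groth_classP a b :
  groth_class a = groth_class b <-> exists k, a.1 + b.2 + k = b.1 + a.2 + k.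
Proof.
split=> [/eqquotP/groth_relP //|h]; by apply/eqquotP/groth_relP.
Qed.

Lemma groth_repr_class a : exists k : S,
  (groth_repr (groth_class a)).1 + a.2 + k =
  a.1 + (groth_repr (groth_class a)).2 + k.
Proof. by apply/groth_classP; rewrite groth_reprK. Qed.

Definition groth_zero := groth_class (0, 0).
Definition groth_opp (x : groth) :=
  let a := groth_repr x in groth_class (a.2, a.1).
Definition groth_add (x y : groth) :=
  let a := groth_repr x in let b := groth_repr y in
  groth_class (a.1 + b.1, a.2 + b.2).
Definition groth_one := groth_class (1, 0).
Definition groth_mul (x y : groth) :=
  let a := groth_repr x in let b := groth_repr y in
  groth_class (a.1 * b.1 + a.2 * b.2, a.1 * b.2 + a.2 * b.1).

Lemma groth_ind (Q : groth -> Prop) :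
  (forall p q : S, Q (groth_class (p, q))) -> forall x, Q x.
Proof. by move=> h x; rewrite -[x]groth_reprK; case: (groth_repr x). Qed.

Lemma groth_oppE a : groth_opp (groth_class a) = groth_class (a.2, a.1).
Proof.
have [k e] := groth_repr_class a.
apply/groth_classP; exists k => /=.
move: (groth_repr _) e => a' e.
by rewrite addrC -addrA; transitivity (a'.1 + a.2 + k); [rewrite e|]; ring.
Qed.

Lemma groth_addE a b : groth_add (groth_class a) (groth_class b) =
  groth_class (a.1 + b.1, a.2 + b.2).
Proof.
have [k e] := groth_repr_class a; have [l f] := groth_repr_class b.
apply/groth_classP; exists (k + l) => /=.
move: (groth_repr (groth_class a)) (groth_repr (groth_class b)) e f => a' b' e f.
transitivity ((a'.1 + a.2 + k) + (b'.1 + b.2 + l)); first ring.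
by rewrite e f; ring.
Qed.

Lemma groth_mulE a b : groth_mul (groth_class a) (groth_class b) =
  groth_class (a.1 * b.1 + a.2 * b.2, a.1 * b.2 + a.2 * b.1).
Proof.
have [k e] := groth_repr_class a; have [l f] := groth_repr_class b.
rewrite /groth_mul.
move: (groth_repr (groth_class a)) (groth_repr (groth_class b)) e f =>
  a' b' e f /=.
transitivity (groth_class (a.1 * b'.1 + a.2 * b'.2, a.1 * b'.2 + a.2 * b'.1)).
  apply/groth_classP; exists (k * b'.1 + k * b'.2) => /=.
  transitivity ((a'.1 + a.2 + k) * b'.1 + (a.1 + a'.2 + k) * b'.2); first ring.
  by rewrite -e {1}e; ring.
apply/groth_classP; exists (a.1 * l + a.2 * l) => /=.
transitivity (a.1 * (b'.1 + b.2 + l) + a.2 * (b.1 + b'.2 + l)); first ring.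
by rewrite [X in _ * X + _]f -[X in _ + _ * X]f; ring.
Qed.

Fact groth_addA : associative groth_add.
Proof.
elim/groth_ind=> a a'; elim/groth_ind=> b b'; elim/groth_ind=> c c'.
by rewrite !groth_addE /= !addrA.
Qed.

Fact groth_addC : commutative groth_add.
Proof.
elim/groth_ind=> a a'; elim/groth_ind=> b b'.
by rewrite !groth_addE /= addrC [a' + b']addrC.
Qed.

Fact groth_add0 : left_id groth_zero groth_add.
Proof. by elim/groth_ind=> a a'; rewrite groth_addE /= !add0r. Qed.

Fact groth_addN : left_inverse groth_zero groth_opp groth_add.
Proof.
elim/groth_ind=> a a'; rewrite groth_oppE groth_addE /=.
by apply/groth_classP; exists 0; rewrite /= !addr0 add0r addrC.
Qed.

HB.instance Definition _ :=
  GRing.isZmodule.Build groth groth_addA groth_addC groth_add0 groth_addN.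

Fact groth_mulA : associative groth_mul.
Proof.
elim/groth_ind=> a a'; elim/groth_ind=> b b'; elim/groth_ind=> c c'.
by rewrite !groth_mulE /=; congr (groth_class (_, _)); ring.
Qed.

Fact groth_mulC : commutative groth_mul.
Proof.
elim/groth_ind=> a a'; elim/groth_ind=> b b'.
by rewrite !groth_mulE /=; congr (groth_class (_, _)); ring.
Qed.

Fact groth_mul1 : left_id groth_one groth_mul.
Proof.
elim/groth_ind=> a a'; rewrite groth_mulE /=.
by congr (groth_class (_, _)); ring.
Qed.

Fact groth_mulDl : left_distributive groth_mul groth_add.
Proof.
elim/groth_ind=> a a'; elim/groth_ind=> b b'; elim/groth_ind=> c c'.
by rewrite !(groth_addE, groth_mulE) /=; congr (groth_class (_, _)); ring.
Qed.

HB.instance Definition _ := GRing.Zmodule_isComPzRing.Build groth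
  groth_mulA groth_mulC groth_mul1 groth_mulDl.

Definition groth_inj (p : S) : groth := groth_class (p, 0).

Lemma groth_classE p q : groth_class (p, q) = groth_inj p - groth_inj q.
Proof.
rewrite /groth_inj [- _]groth_oppE [_ + _]groth_addE /=.
by rewrite add0r addr0.
Qed.

Lemma groth_injD p q : groth_inj (p + q) = groth_inj p + groth_inj q.
Proof. by rewrite [_ + _ in RHS]groth_addE /= addr0. Qed.

Lemma groth_injM p q : groth_inj (p * q) = groth_inj p * groth_inj q.
Proof. by rewrite [_ * _ in RHS]groth_mulE /= !(mulr0, mul0r, addr0). Qed.

Lemma groth_inj1 : groth_inj 1 = 1.
Proof. by []. Qed.

End GrothendieckRing.

Section GrothendieckBiadditive.
Variables (S T : comPzSemiRingType) (V : zmodType) (f : S -> T -> V).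

Definition groth_lift2 (x : groth S) (y : groth T) : V :=
  let a := groth_repr x in let b := groth_repr y in
  (f a.1 b.1 + f a.2 b.2) - (f a.1 b.2 + f a.2 b.1).

Hypothesis fDl : forall p p' q, f (p + p') q = f p q + f p' q.
Hypothesis fDr : forall p q q', f p (q + q') = f p q + f p q'.

Lemma groth_lift2E a b : groth_lift2 (groth_class a) (groth_class b) =
  (f a.1 b.1 + f a.2 b.2) - (f a.1 b.2 + f a.2 b.1).
Proof.
have [k e] := groth_repr_class a; have [l g] := groth_repr_class b.
rewrite /groth_lift2.
move: (groth_repr (groth_class a)) (groth_repr (groth_class b)) e g =>
  a' b' e g /=.
have E q : f a'.1 q - f a'.2 q = f a.1 q - f a.2 q.
  have := congr1 (f^~ q) e; rewrite !fDl => /addIr h.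
  by apply/eqP; rewrite subr_eq addrAC -h addrK.
have F p : f p b'.1 - f p b'.2 = f p b.1 - f p b.2.
  have := congr1 (f p) g; rewrite !fDr => /addIr h.
  by apply/eqP; rewrite subr_eq addrAC -h addrK.
have K (u v w z : V) : u + v - (w + z) = (u - w) - (z - v).
  by rewrite opprD opprB addrACA [v - z]addrC [- z + v]addrC.
rewrite [LHS]K !F -[LHS]K [f _ _ + f _ _ in X in _ - X]addrC.
by rewrite [LHS]K !E -[LHS]K [f _ _ + f _ _ in X in _ - X]addrC.
Qed.

Lemma groth_lift2_inj p q : groth_lift2 (groth_inj p) (groth_inj q) = f p q.
Proof.
have f0l r : f 0 r = 0 by apply: (addrI (f 0 r)); rewrite -fDl !addr0.
have f0r r : f r 0 = 0 by apply: (addrI (f r 0)); rewrite -fDr !addr0.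
by rewrite groth_lift2E /= !(f0l, f0r) !addr0 subr0.
Qed.

Lemma groth_lift2Dl x x' y :
  groth_lift2 (x + x') y = groth_lift2 x y + groth_lift2 x' y.
Proof.
elim/groth_ind: x => p p'; elim/groth_ind: x' => q q'.
elim/groth_ind: y => r r'.
rewrite [groth_class (p, _) + _]groth_addE !groth_lift2E /= !fDl.
rewrite [in LHS]addrACA [f p r' + _ + _]addrACA opprD.
by rewrite [LHS]addrACA.
Qed.

Lemma groth_lift2Dr x y y' :
  groth_lift2 x (y + y') = groth_lift2 x y + groth_lift2 x y'.
Proof.
elim/groth_ind: x => p p'; elim/groth_ind: y => q q'.
elim/groth_ind: y' => r r'.
rewrite [groth_class (q, _) + _]groth_addE !groth_lift2E /= !fDr.
rewrite [in LHS]addrACA [f p q' + _ + _]addrACA opprD.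
by rewrite [LHS]addrACA.
Qed.

End GrothendieckBiadditive.
Section GSets.
Variable Gam : finGroupType.

Definition is_left_action (T : Type) (act : Gam -> T -> T) : Prop :=
  (forall x, act 1%g x = x) /\
  (forall a b x, act (a * b)%g x = act a (act b x)).

(* Finite left sets; the library's actions are right actions. *)
Record gset := GSet {
  gset_carrier :> finType;
  gset_act : Gam -> gset_carrier -> gset_carrier;
  gset_actP : is_left_action gset_act }.

Lemma gset_act1 (X : gset) (x : X) : gset_act 1%g x = x.
Proof. by case: (gset_actP X) => h _; apply: h. Qed.

Lemma gset_actM (X : gset) a b (x : X) :
  gset_act (a * b)%g x = gset_act a (gset_act b x).
Proof. by case: (gset_actP X) => _ h; apply: h. Qed.

Lemma gset_actK (X : gset) a : cancel (@gset_act X a) (gset_act a^-1%g).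
Proof. by move=> x; rewrite -gset_actM mulVg gset_act1. Qed.

Lemma gset_actVK (X : gset) a : cancel (@gset_act X a^-1%g) (gset_act a).
Proof. by move=> x; rewrite -gset_actM mulgV gset_act1. Qed.

Definition gset_transitive (X : gset) : Prop :=
  exists x : X, forall y : X, exists a, y = gset_act a x.

Definition gset_iso (X Y : gset) : Prop :=
  exists f : X -> Y, bijective f /\
    forall a x, f (gset_act a x) = gset_act a (f x).

Lemma gset_iso_refl X : gset_iso X X.
Proof. by exists id; split=> //; exists id. Qed.

Lemma gset_iso_sym X Y : gset_iso X Y -> gset_iso Y X.
Proof.
case=> f [[g fK gK] hf]; exists g; split; first by exists f.
by move=> a y; rewrite -{1}[y]gK -hf fK.
Qed.

Lemma gset_iso_trans Y X Z : gset_iso X Y -> gset_iso Y Z -> gset_iso X Z.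
Proof.
case=> f [bf hf] [g [bg hg]]; exists (g \o f).
by split; [exact: bij_comp | move=> a x /=; rewrite hf hg].
Qed.

Definition empty_act (a : Gam) (x : void) : void := x.
Fact empty_actP : is_left_action empty_act. Proof. by split=> // -[]. Qed.
Definition gset_empty := GSet empty_actP.

Definition point_act (a : Gam) (x : unit) : unit := x.
Fact point_actP : is_left_action point_act. Proof. by []. Qed.
Definition gset_point := GSet point_actP.

Definition sum_act (X Y : gset) (a : Gam) (u : X + Y) : X + Y :=
  match u with
  | inl x => inl (gset_act a x)
  | inr y => inr (gset_act a y)
  end.
Fact sum_actP X Y : is_left_action (@sum_act X Y).
Proof.
split=> [|a b] [x|y] /=; by rewrite (gset_act1, gset_actM).
Qed.
Definition gset_sum X Y := GSet (@sum_actP X Y).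

Definition prod_act (X Y : gset) (a : Gam) (u : X * Y) : X * Y :=
  (gset_act a u.1, gset_act a u.2).
Fact prod_actP X Y : is_left_action (@prod_act X Y).
Proof.
by split=> [|a b] [x y]; rewrite /prod_act /= ?gset_act1 ?gset_actM.
Qed.
Definition gset_prod X Y := GSet (@prod_actP X Y).

Lemma gset_iso_sum X X' Y Y' : gset_iso X X' -> gset_iso Y Y' ->
  gset_iso (gset_sum X Y) (gset_sum X' Y').
Proof.
case=> f [[f' fK f'K] hf] [g [[g' gK g'K] hg]].
exists (fun u => match u with inl x => inl (f x) | inr y => inr (g y) end).
split; last by move=> a [x|y] /=; rewrite (hf, hg).
exists (fun u => match u with inl x => inl (f' x) | inr y => inr (g' y) end).
  by move=> [x|y]; rewrite (fK, gK).
by move=> [x|y]; rewrite (f'K, g'K).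
Qed.

Lemma gset_iso_prod X X' Y Y' : gset_iso X X' -> gset_iso Y Y' ->
  gset_iso (gset_prod X Y) (gset_prod X' Y').
Proof.
case=> f [[f' fK f'K] hf] [g [[g' gK g'K] hg]].
exists (fun u => (f u.1, g u.2)).
split; last by move=> a [x y]; rewrite /= hf hg.
by exists (fun u => (f' u.1, g' u.2)) => -[x y]; rewrite /= ?(fK, gK, f'K, g'K).
Qed.

(* Every finite set with an action is isomorphic to some 'I_m, with an action
   given by permutations; quantifying over these only keeps the type of
   isomorphism classes small. As (s * t)%g x = t (s x) in 'S_m, a left action is
   an antimorphism. *)
Definition gset_code : Type :=
  {x : {m : nat & {ffun Gam -> 'S_m}} |
    [forall a, forall b,
      tagged x (a * b)%g == (tagged x b * tagged x a)%g]}.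

HB.instance Definition _ := Choice.on gset_code.

Definition decode_act (r : gset_code) (a : Gam) (i : 'I_(tag (val r))) :=
  tagged (val r) a i.

Fact decode_actP r : is_left_action (@decode_act r).
Proof.
have hM a b : tagged (val r) (a * b)%g = (tagged (val r) b * tagged (val r) a)%g.
  by have /forallP/(_ a)/forallP/(_ b)/eqP := valP r.
have h1 : tagged (val r) 1%g = 1%g.
  by apply: (mulgI (tagged (val r) 1%g)); rewrite -hM !mulg1.
by split=> [x|a b x]; rewrite /decode_act ?h1 ?hM ?permM ?perm1.
Qed.

Definition gset_decode r := GSet (@decode_actP r).

Definition encode_fun (X : gset) (a : Gam) (i : 'I_#|X|) : 'I_#|X| :=
  enum_rank (gset_act a (enum_val i)).

Fact encode_fun_inj X a : injective (@encode_fun X a).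
Proof.
by move=> i j /enum_rank_inj/(can_inj (@gset_actK X a))/enum_val_inj.
Qed.

Definition encode_pair (X : gset) : {m : nat & {ffun Gam -> 'S_m}} :=
  Tagged (fun m => {ffun Gam -> 'S_m}) [ffun a => perm (@encode_fun_inj X a)].

Fact encode_pairP X : [forall a, forall b,
  tagged (encode_pair X) (a * b)%g ==
  (tagged (encode_pair X) b * tagged (encode_pair X) a)%g].
Proof.
apply/forallP=> a; apply/forallP=> b; apply/eqP/permP=> i.
by rewrite permM /= !ffunE !permE /encode_fun enum_rankK gset_actM.
Qed.

Definition gset_encode X : gset_code := exist _ (encode_pair X) (encode_pairP X).

Lemma gset_encodeK X : gset_iso (gset_decode (gset_encode X)) X.
Proof.
exists (fun i : 'I_#|X| => enum_val i); split.
  by exists enum_rank; [exact: enum_valK | exact: enum_rankK].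
move=> a i; rewrite /= /decode_act /= ffunE permE /encode_fun.
by rewrite enum_rankK.
Qed.

Definition gset_code_iso (r s : gset_code) : bool :=
  `[< gset_iso (gset_decode r) (gset_decode s) >].

Fact gset_code_iso_refl : reflexive gset_code_iso.
Proof. by move=> r; apply/asboolP/gset_iso_refl. Qed.

Fact gset_code_iso_sym : symmetric gset_code_iso.
Proof. by move=> r s; apply/asboolP/asboolP => /gset_iso_sym. Qed.

Fact gset_code_iso_trans : transitive gset_code_iso.
Proof.
move=> s r t /asboolP h /asboolP k.
by apply/asboolP; apply: gset_iso_trans h k.
Qed.

Canonical gset_code_equiv :=
  EquivRel gset_code_iso gset_code_iso_refl gset_code_iso_sym gset_code_iso_trans.

Definition isoclasses := {eq_quot gset_code_equiv}.

HB.instance Definition _ := Choice.on isoclasses.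

Definition isoclass (X : gset) : isoclasses :=
  \pi_{eq_quot gset_code_equiv} (gset_encode X).
Definition isoclass_repr (x : isoclasses) : gset :=
  gset_decode (repr (x : {eq_quot gset_code_equiv})).

Lemma isoclassP X Y : isoclass X = isoclass Y <-> gset_iso X Y.
Proof.
have hX := gset_encodeK X; have hY := gset_encodeK Y.
split=> [/eqquotP/asboolP h|h].
  exact: gset_iso_trans (gset_iso_sym hX) (gset_iso_trans h hY).
apply/eqquotP/asboolP.
exact: gset_iso_trans hX (gset_iso_trans h (gset_iso_sym hY)).
Qed.

Lemma isoclass_reprK x : isoclass (isoclass_repr x) = x.
Proof.
rewrite -[RHS](reprK (x : {eq_quot gset_code_equiv})).
exact/eqquotP/asboolP/gset_encodeK.
Qed.

Lemma isoclass_repr_iso X : gset_iso (isoclass_repr (isoclass X)) X.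
Proof. by apply/isoclassP; rewrite isoclass_reprK. Qed.

Lemma isoclass_ind (Q : isoclasses -> Prop) :
  (forall X, Q (isoclass X)) -> forall x, Q x.
Proof. by move=> h x; rewrite -[x]isoclass_reprK. Qed.

Definition isoclass_add (x y : isoclasses) :=
  isoclass (gset_sum (isoclass_repr x) (isoclass_repr y)).
Definition isoclass_mul (x y : isoclasses) :=
  isoclass (gset_prod (isoclass_repr x) (isoclass_repr y)).

Lemma isoclass_addE X Y :
  isoclass_add (isoclass X) (isoclass Y) = isoclass (gset_sum X Y).
Proof. by apply/isoclassP/gset_iso_sum; exact: isoclass_repr_iso. Qed.

Lemma isoclass_mulE X Y :
  isoclass_mul (isoclass X) (isoclass Y) = isoclass (gset_prod X Y).
Proof. by apply/isoclassP/gset_iso_prod; exact: isoclass_repr_iso. Qed.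

Fact isoclass_addA : associative isoclass_add.
Proof.
elim/isoclass_ind=> X; elim/isoclass_ind=> Y; elim/isoclass_ind=> Z.
rewrite !isoclass_addE; apply/isoclassP.
exists (fun u => match u with
  | inl x => inl (inl x) | inr (inl y) => inl (inr y) | inr (inr z) => inr z
  end); split; last by move=> a [x|[y|z]].
exists (fun u => match u with
  | inl (inl x) => inl x | inl (inr y) => inr (inl y) | inr z => inr (inr z)
  end); by [case=> [x|[y|z]] | case=> [[x|y]|z]].
Qed.

Fact isoclass_addC : commutative isoclass_add.
Proof.
elim/isoclass_ind=> X; elim/isoclass_ind=> Y.
rewrite !isoclass_addE; apply/isoclassP.
exists (fun u => match u with inl x => inr x | inr y => inl y end).
split; last by move=> a [x|y].
by exists (fun u => match u with inl x => inr x | inr y => inl y end); case.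
Qed.

Fact isoclass_add0 : left_id (isoclass gset_empty) isoclass_add.
Proof.
elim/isoclass_ind=> X; rewrite isoclass_addE; apply/isoclassP.
exists (fun u : void + X => match u with
  | inl v => match v with end | inr x => x end).
split; last by move=> a [[]|x].
by exists inr => // -[[]|x].
Qed.

HB.instance Definition _ :=
  GRing.isNmodule.Build isoclasses isoclass_addA isoclass_addC isoclass_add0.

Fact isoclass_mulA : associative isoclass_mul.
Proof.
elim/isoclass_ind=> X; elim/isoclass_ind=> Y; elim/isoclass_ind=> Z.
rewrite !isoclass_mulE; apply/isoclassP.
exists (fun u => ((u.1, u.2.1), u.2.2)); split=> //.
by exists (fun u => (u.1.1, (u.1.2, u.2))) => [[x [y z]]|[[x y] z]].
Qed.

Fact isoclass_mulC : commutative isoclass_mul.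
Proof.
elim/isoclass_ind=> X; elim/isoclass_ind=> Y.
rewrite !isoclass_mulE; apply/isoclassP.
exists (fun u => (u.2, u.1)); split=> //.
by exists (fun u => (u.2, u.1)) => -[].
Qed.

Fact isoclass_mul1 : left_id (isoclass gset_point) isoclass_mul.
Proof.
elim/isoclass_ind=> X; rewrite isoclass_mulE; apply/isoclassP.
exists snd; split=> //.
by exists (pair tt) => // -[[]].
Qed.

Fact isoclass_mulDl : left_distributive isoclass_mul isoclass_add.
Proof.
elim/isoclass_ind=> X; elim/isoclass_ind=> Y; elim/isoclass_ind=> Z.
rewrite !(isoclass_mulE, isoclass_addE); apply/isoclassP.
exists (fun u => match u.1 with
  | inl x => inl (x, u.2) | inr y => inr (y, u.2) end).
split; last by move=> a [[x|y] z].
by exists (fun u => match u with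
  | inl v => (inl v.1, v.2) | inr v => (inr v.1, v.2) end)
  => [[[x|y] z]|[[x z]|[y z]]].
Qed.

Fact isoclass_mul0 : left_zero (isoclass gset_empty) isoclass_mul.
Proof.
elim/isoclass_ind=> X; rewrite isoclass_mulE; apply/isoclassP.
exists fst; split=> //.
by exists (fun v : void => match v with end) => [[[]]|[]].
Qed.

HB.instance Definition _ := GRing.Nmodule_isComPzSemiRing.Build isoclasses
  isoclass_mulA isoclass_mulC isoclass_mul1 isoclass_mulDl isoclass_mul0.

Definition burnside := groth isoclasses.

HB.instance Definition _ := GRing.ComPzRing.on burnside.

Definition burnside_class (X : gset) : burnside := groth_inj (isoclass X).

Lemma burnside_class_iso X Y :
  gset_iso X Y -> burnside_class X = burnside_class Y.
Proof. by move/isoclassP; rewrite /burnside_class => ->. Qed.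

Lemma burnside_classD X Y :
  burnside_class (gset_sum X Y) = burnside_class X + burnside_class Y.
Proof. by rewrite /burnside_class -isoclass_addE groth_injD. Qed.

Lemma burnside_classM X Y :
  burnside_class (gset_prod X Y) = burnside_class X * burnside_class Y.
Proof. by rewrite /burnside_class -isoclass_mulE groth_injM. Qed.

Lemma burnside_class_empty : burnside_class gset_empty = 0.
Proof. by []. Qed.

Lemma burnside_class_point : burnside_class gset_point = 1.
Proof. by []. Qed.

Lemma burnside_classB (x : burnside) :
  exists X Y, x = burnside_class X - burnside_class Y.
Proof.
elim/groth_ind: x => p q; rewrite groth_classE.
by elim/isoclass_ind: p => X; elim/isoclass_ind: q => Y; exists X, Y.
Qed.

Definition canonical_basis : set burnside :=
  [set u | exists X : gset, gset_transitive X /\ u = burnside_class X].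

End GSets.

Section IntSpan.
Variable V : zmodType.
Implicit Type B : set V.

Definition int_span B : set V :=
  [set u | exists (k : nat) (c : 'I_k -> int) (b : 'I_k -> V),
     (forall i, B (b i)) /\ u = \sum_i b i *~ c i].

Lemma int_span_sub B u : B u -> int_span B u.
Proof. by exists 1, (fun=> 1), (fun=> u); split=> //; rewrite big_ord1. Qed.

Lemma int_span0 B : int_span B 0.
Proof. by exists 0, (fun=> 1), (fun=> 0); split=> [[]|] //; rewrite big_ord0. Qed.

Lemma int_spanD B u v : int_span B u -> int_span B v -> int_span B (u + v).
Proof.
move=> [k [c [b [hb ->]]]] [l [d [e [he ->]]]].
exists (k + l)%N, (fun i => match split i with inl i => c i | inr i => d i end),
  (fun i => match split i with inl i => b i | inr i => e i end).
split=> [i|]; first by case: split.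
rewrite big_split_ord /=.
by congr (_ + _); apply: eq_bigr => i _; rewrite -?[lshift _ _]/(unsplit (inl i))
  -?[rshift _ _]/(unsplit (inr i)) unsplitK.
Qed.

Lemma int_spanZ B u (m : int) : int_span B u -> int_span B (u *~ m).
Proof.
move=> [k [c [b [hb ->]]]]; exists k, (fun i => c i * m), b; split=> //.
by rewrite mulrz_suml; apply: eq_bigr => i _; rewrite mulrzA.
Qed.

Lemma int_spanB B u v : int_span B u -> int_span B v -> int_span B (u - v).
Proof. by move=> hu /(int_spanZ (- 1)); rewrite mulrNz mulr1z; apply: int_spanD. Qed.

Lemma int_span_sum B (k : nat) (F : 'I_k -> V) :
  (forall i, int_span B (F i)) -> int_span B (\sum_i F i).
Proof.
by move=> h; elim/big_ind: _ => //; [exact: int_span0 | exact: int_spanD].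
Qed.

End IntSpan.

Lemma int_spanM (R : pzRingType) (B : set R) u v :
  (forall u v, B u -> B v -> B (u * v)) ->
  int_span B u -> int_span B v -> int_span B (u * v).
Proof.
move=> hB [k [c [b [hb ->]]]] [l [d [e [he ->]]]].
rewrite mulr_suml; apply: int_span_sum => i.
rewrite mulr_sumr; apply: int_span_sum => j.
rewrite mulrzAl mulrzAr; do 2 apply: int_spanZ.
by apply: int_span_sub; apply: hB.
Qed.

Section Induction.
Variables (H Gam : finGroupType) (phi : {morphism [set: H] >-> Gam}).

Let phiM h k : phi (h * k)%g = (phi h * phi k)%g.
Proof. by rewrite morphM ?inE. Qed.

Let phiV h : phi h^-1%g = (phi h)^-1%g.
Proof. by rewrite morphV ?inE. Qed.

Section Carrier.
Variable Z : gset H.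

(* (a phi(h), z) ~ (a, h z) *)
Definition induced_rel (p q : Gam * Z) : bool :=
  [exists h : H, (p.1 == q.1 * phi h)%g && (q.2 == gset_act h p.2)].

Lemma induced_relP p q :
  reflect (exists h : H, p.1 = (q.1 * phi h)%g /\ q.2 = gset_act h p.2)
    (induced_rel p q).
Proof.
apply: (iffP existsP) => [[h /andP[/eqP e /eqP f]]|[h [e f]]]; exists h => //.
by rewrite -e -f !eqxx.
Qed.

Fact induced_rel_refl : reflexive induced_rel.
Proof.
by move=> p; apply/induced_relP; exists 1%g; rewrite morph1 mulg1 gset_act1.
Qed.

Fact induced_rel_sym : symmetric induced_rel.
Proof.
by move=> p q; apply/induced_relP/induced_relP => -[h [-> ->]]; exists h^-1%g;
  rewrite phiV mulgK gset_actK.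
Qed.

Fact induced_rel_trans : transitive induced_rel.
Proof.
move=> q p r /induced_relP[h [e f]] /induced_relP[k [e' f']].
by apply/induced_relP; exists (k * h)%g; rewrite e e' phiM mulgA f' f gset_actM.
Qed.

Canonical induced_equiv :=
  EquivRel induced_rel induced_rel_refl induced_rel_sym induced_rel_trans.

Definition induced_type := {eq_quot induced_equiv}.
HB.instance Definition _ := Quotient.on induced_type.
HB.instance Definition _ := [Finite of induced_type by <:%/].

Definition induced_class (p : Gam * Z) : induced_type := \pi_induced_type p.

Lemma induced_classP p q : induced_class p = induced_class q <->
  exists h : H, p.1 = (q.1 * phi h)%g /\ q.2 = gset_act h p.2.
Proof. by split=> [/eqquotP/induced_relP //|h]; apply/eqquotP/induced_relP. Qed.

Definition induced_act (a : Gam) (x : induced_type) : induced_type :=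
  induced_class ((a * (repr x).1)%g, (repr x).2).

Lemma induced_actE a p :
  induced_act a (induced_class p) = induced_class ((a * p.1)%g, p.2).
Proof.
have /induced_classP[h [e f]] : induced_class (repr (induced_class p)) =
  induced_class p by exact: reprK.
by apply/induced_classP; exists h; rewrite /= e mulgA.
Qed.

Lemma induced_ind (Q : induced_type -> Prop) :
  (forall a z, Q (induced_class (a, z))) -> forall x, Q x.
Proof. by move=> h x; rewrite -[x]reprK; case: (repr x). Qed.

Fact induced_actP : is_left_action induced_act.
Proof.
split=> [|a b]; elim/induced_ind=> c z; rewrite !induced_actE /= ?mul1g //.
by rewrite mulgA.
Qed.

(* The balanced product Gam x_H Z. *)
Definition induced : gset Gam := GSet induced_actP.

End Carrier.

Lemma gset_iso_induced Z Z' : gset_iso Z Z' ->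
  gset_iso (induced Z) (induced Z').
Proof.
case=> f [[f' fK f'K] hf].
have hf' a z : f' (gset_act a z) = gset_act a (f' z).
  by rewrite -[z in LHS]f'K -hf fK.
pose F (x : induced_type Z) : induced_type Z' :=
  induced_class ((repr x).1, f (repr x).2).
pose F' (x : induced_type Z') : induced_type Z :=
  induced_class ((repr x).1, f' (repr x).2).
have FE p : F (induced_class p) = induced_class (p.1, f p.2).
  have /induced_classP[h [e g]] : induced_class (repr (induced_class p)) =
    induced_class p by exact: reprK.
  by apply/induced_classP; exists h; rewrite /= e g hf.
have F'E p : F' (induced_class p) = induced_class (p.1, f' p.2).
  have /induced_classP[h [e g]] : induced_class (repr (induced_class p)) =
    induced_class p by exact: reprK.
  by apply/induced_classP; exists h; rewrite /= e g hf'.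
exists F; split.
  exists F'; elim/induced_ind=> a z; first by rewrite FE F'E /= fK.
  by rewrite F'E FE /= f'K.
by move=> a; elim/induced_ind=> b z; rewrite /= !(FE, induced_actE).
Qed.

Lemma gset_iso_induced_sum Z Z' :
  gset_iso (induced (gset_sum Z Z')) (gset_sum (induced Z) (induced Z')).
Proof.
pose F (x : induced_type (gset_sum Z Z')) : induced_type Z + induced_type Z' :=
  match (repr x).2 with
  | inl z => inl (induced_class ((repr x).1, z))
  | inr z => inr (induced_class ((repr x).1, z))
  end.
pose J (x : induced_type Z) : induced_type (gset_sum Z Z') :=
  @induced_class (gset_sum Z Z') ((repr x).1, inl (repr x).2).
pose J' (x : induced_type Z') : induced_type (gset_sum Z Z') :=
  @induced_class (gset_sum Z Z') ((repr x).1, inr (repr x).2).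
have JE p : J (induced_class p) =
    @induced_class (gset_sum Z Z') (p.1, inl p.2).
  have /induced_classP[h [e g]] : induced_class (repr (induced_class p)) =
    induced_class p by exact: reprK.
  by apply/induced_classP; exists h; rewrite /= e g.
have J'E p : J' (induced_class p) =
    @induced_class (gset_sum Z Z') (p.1, inr p.2).
  have /induced_classP[h [e g]] : induced_class (repr (induced_class p)) =
    induced_class p by exact: reprK.
  by apply/induced_classP; exists h; rewrite /= e g.
have FE a (u : Z + Z') : F (@induced_class (gset_sum Z Z') (a, u)) = match u with
    | inl z => inl (induced_class (a, z)) | inr z => inr (induced_class (a, z))
    end.
  have /induced_classP[h []] :
    induced_class (repr (@induced_class (gset_sum Z Z') (a, u))) =
    @induced_class (gset_sum Z Z') (a, u) by exact: reprK.
  rewrite /F; case: (repr _) => b v /= -> ->.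
  by case: v => z /=; congr (_ _); apply/induced_classP; exists h.
exists F; split.
  exists (fun u => match u with inl x => J x | inr x => J' x end).
    by elim/induced_ind=> a [z|z]; rewrite FE ?JE ?J'E.
  by case; elim/induced_ind=> a z; rewrite ?JE ?J'E FE.
by move=> a; elim/induced_ind=> b [z|z]; rewrite /= induced_actE !FE /= induced_actE.
Qed.

End Induction.

Section ExternalProduct.
Variables H K : finGroupType.

Definition boxprod_act (X : gset H) (Y : gset K) (a : H * K) (u : X * Y) :
  X * Y := (gset_act a.1 u.1, gset_act a.2 u.2).

Fact boxprod_actP X Y : is_left_action (@boxprod_act X Y).
Proof.
by split=> [|a b] [x y]; rewrite /boxprod_act /= ?gset_act1 ?gset_actM.
Qed.

Definition boxprod X Y : gset (H * K)%type := GSet (@boxprod_actP X Y).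

Lemma gset_iso_boxprod X X' Y Y' : gset_iso X X' -> gset_iso Y Y' ->
  gset_iso (boxprod X Y) (boxprod X' Y').
Proof.
case=> f [[f' fK f'K] hf] [g [[g' gK g'K] hg]].
exists (fun u => (f u.1, g u.2)).
split; last by move=> a [x y]; rewrite /= hf hg.
by exists (fun u => (f' u.1, g' u.2)) => -[x y]; rewrite /= ?(fK, gK, f'K, g'K).
Qed.

Lemma gset_iso_boxprod_suml X X' Y :
  gset_iso (boxprod (gset_sum X X') Y) (gset_sum (boxprod X Y) (boxprod X' Y)).
Proof.
exists (fun u => match u.1 with
  | inl x => inl (x, u.2) | inr x => inr (x, u.2) end).
split; last by move=> a [[x|x] y].
by exists (fun u => match u with
  | inl v => (inl v.1, v.2) | inr v => (inr v.1, v.2) end)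
  => [[[x|x] y]|[[x y]|[x y]]].
Qed.

Lemma gset_iso_boxprod_sumr X Y Y' :
  gset_iso (boxprod X (gset_sum Y Y')) (gset_sum (boxprod X Y) (boxprod X Y')).
Proof.
exists (fun u => match u.2 with
  | inl y => inl (u.1, y) | inr y => inr (u.1, y) end).
split; last by move=> a [x [y|y]].
by exists (fun u => match u with
  | inl v => (v.1, inl v.2) | inr v => (v.1, inr v.2) end)
  => [[x [y|y]]|[[x y]|[x y]]].
Qed.

End ExternalProduct.

Section Wreath.
Variables (G : finGroupType) (n : nat).

Record wreath := Wreath { wbase : {ffun 'I_n -> G}; wperm : 'S_n }.

Definition wreath_pair (a : wreath) := (wbase a, wperm a).
Definition pair_wreath u : wreath := Wreath u.1 u.2.
Fact wreath_pairK : cancel wreath_pair pair_wreath. Proof. by case. Qed.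

HB.instance Definition _ := Finite.copy wreath (can_type wreath_pairK).

(* (s * t)%g is "first s, then t" in 'S_n, so the composite permutation
   wperm a \o wperm b is (wperm b * wperm a)%g. *)
Definition wreath_mul (a b : wreath) : wreath :=
  Wreath [ffun i => wbase a i * wbase b ((wperm a)^-1 i)]%g
         (wperm b * wperm a)%g.
Definition wreath_one : wreath := Wreath [ffun=> 1%g] 1%g.
Definition wreath_inv (a : wreath) : wreath :=
  Wreath [ffun i => (wbase a (wperm a i))^-1]%g (wperm a)^-1%g.

Fact wreath_mulA : associative wreath_mul.
Proof.
move=> a b c; congr Wreath; last by rewrite /= mulgA.
by apply/ffunP=> i; rewrite !ffunE /= mulgA invMg permM.
Qed.

Fact wreath_mul1 : left_id wreath_one wreath_mul.
Proof.
case=> f s; congr Wreath; last by rewrite /= mulg1.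
by apply/ffunP=> i; rewrite !ffunE /= mul1g invg1 perm1.
Qed.

Fact wreath_mulV : left_inverse wreath_one wreath_inv wreath_mul.
Proof.
case=> f s; congr Wreath; last by rewrite /= mulgV.
by apply/ffunP=> i; rewrite !ffunE /= invgK mulVg.
Qed.

HB.instance Definition _ :=
  Finite_isGroup.Build wreath wreath_mulA wreath_mul1 wreath_mulV.

Definition power_act (Y : Type) (act : G -> Y -> Y) (a : wreath)
    (y : 'I_n -> Y) : 'I_n -> Y :=
  fun i => act (wbase a i) (y ((wperm a)^-1%g i)).

Definition gset_power_act (X : gset G) (a : wreath) (x : {ffun 'I_n -> X}) :
  {ffun 'I_n -> X} := finfun (power_act (@gset_act G X) a x).

Fact gset_power_actP X : is_left_action (@gset_power_act X).
Proof.
split=> [x|a b x]; apply/ffunP=> i; rewrite !ffunE /power_act /=.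
  by rewrite ffunE invg1 perm1 gset_act1.
by rewrite !ffunE /= gset_actM invMg permM.
Qed.

Definition gset_power X : gset wreath := GSet (@gset_power_actP X).

(* Y is not required to be finite. *)
Definition submissive (X : gset wreath) : Prop :=
  exists (Y : Type) (act : G -> Y -> Y), is_left_action act /\
  exists f : X -> 'I_n -> Y, injective f /\
    forall a x, f (gset_act a x) = power_act act a (f x).

End Wreath.

Section Embedding.
Variables (G : finGroupType) (i j n : nat) (e : (i + j)%N = n).

(* The blocks {0,...,i-1} and {i,...,n-1} of 'I_n. *)
Definition block_split (k : 'I_n) : 'I_i + 'I_j := split (cast_ord (esym e) k).
Definition block_unsplit (u : 'I_i + 'I_j) : 'I_n := cast_ord e (unsplit u).

Lemma block_splitK : cancel block_split block_unsplit.
Proof. by move=> k; rewrite /block_unsplit splitK cast_ordKV. Qed.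

Lemma block_unsplitK : cancel block_unsplit block_split.
Proof. by move=> u; rewrite /block_split cast_ordK unsplitK. Qed.

Definition block_fun (s : 'S_i) (t : 'S_j) (k : 'I_n) : 'I_n :=
  block_unsplit (match block_split k with
                 | inl x => inl (s x)
                 | inr y => inr (t y)
                 end).

Fact block_fun_inj s t : injective (block_fun s t).
Proof.
move=> k l /(can_inj block_unsplitK) h; apply: (can_inj block_splitK).
by case: (block_split k) (block_split l) h => x [] y // [] /perm_inj ->.
Qed.

Definition block_perm s t : 'S_n := perm (@block_fun_inj s t).

Definition wreath_embed (u : wreath G i * wreath G j) : wreath G n :=
  Wreath [ffun k => match block_split k with
                    | inl x => wbase u.1 x
                    | inr y => wbase u.2 y
                    end]
         (block_perm (wperm u.1) (wperm u.2)).

Lemma block_permM s s' t t' :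
  block_perm (s * s')%g (t * t')%g = (block_perm s t * block_perm s' t')%g.
Proof.
apply/permP=> k; rewrite permM !permE /block_fun block_unsplitK.
by case: block_split => x; rewrite permM.
Qed.

Lemma block_perm1 : block_perm 1%g 1%g = 1%g.
Proof.
apply/permP=> k; rewrite permE perm1 /block_fun -[RHS]block_splitK.
by case: block_split => x; rewrite perm1.
Qed.

Lemma block_permV s t : block_perm s^-1%g t^-1%g = (block_perm s t)^-1%g.
Proof. by apply/eqP; rewrite eq_sym eq_invg_mul -block_permM !mulgV block_perm1. Qed.

Fact wreath_embedM : {in [set: wreath G i * wreath G j] &,
  {morph wreath_embed : u v / (u * v)%g}}.
Proof.
move=> u v _ _; congr Wreath; last by rewrite -block_permM.
apply/ffunP=> k; rewrite !ffunE /= -block_permV permE /block_fun block_unsplitK.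
by case: block_split => x; rewrite !ffunE.
Qed.

Canonical wreath_embed_morphism := Morphism wreath_embedM.

Lemma wreath_embed_inj : injective wreath_embed.
Proof.
move=> [[f s] [g t]] [[f' s'] [g' t']] [/ffunP hf /permP hs].
have hl x : f x = f' x /\ s x = s' x.
  have := hf (block_unsplit (inl x)); have := hs (block_unsplit (inl x)).
  rewrite !ffunE !permE /block_fun !block_unsplitK.
  by move/(can_inj block_unsplitK) => -[].
have hr x : g x = g' x /\ t x = t' x.
  have := hf (block_unsplit (inr x)); have := hs (block_unsplit (inr x)).
  rewrite !ffunE !permE /block_fun !block_unsplitK.
  by move/(can_inj block_unsplitK) => -[].
have -> : f = f' by apply/ffunP=> x; have [] := hl x.
have -> : s = s' by apply/permP=> x; have [] := hl x.
have -> : g = g' by apply/ffunP=> x; have [] := hr x.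
by have -> : t = t' by apply/permP=> x; have [] := hr x.
Qed.

Definition star_gset (X : gset (wreath G i)) (Y : gset (wreath G j)) :
  gset (wreath G n) := induced wreath_embed_morphism (boxprod X Y).

Definition star_isoclass (x : isoclasses (wreath G i))
    (y : isoclasses (wreath G j)) : burnside (wreath G n) :=
  burnside_class (star_gset (isoclass_repr x) (isoclass_repr y)).

Definition star : burnside (wreath G i) -> burnside (wreath G j) ->
  burnside (wreath G n) := groth_lift2 star_isoclass.

Lemma star_isoclassE X Y :
  star_isoclass (isoclass X) (isoclass Y) = burnside_class (star_gset X Y).
Proof.
apply: burnside_class_iso; apply: gset_iso_induced.
by apply: gset_iso_boxprod; apply: isoclass_repr_iso.
Qed.

Lemma star_isoclassDl x x' y :
  star_isoclass (x + x') y = star_isoclass x y + star_isoclass x' y.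
Proof.
elim/isoclass_ind: x => X; elim/isoclass_ind: x' => X'.
elim/isoclass_ind: y => Y.
rewrite [isoclass X + _]isoclass_addE !star_isoclassE -burnside_classD.
apply: burnside_class_iso; apply: gset_iso_trans (gset_iso_induced_sum _ _ _).
exact/gset_iso_induced/gset_iso_boxprod_suml.
Qed.

Lemma star_isoclassDr x y y' :
  star_isoclass x (y + y') = star_isoclass x y + star_isoclass x y'.
Proof.
elim/isoclass_ind: x => X; elim/isoclass_ind: y => Y.
elim/isoclass_ind: y' => Y'.
rewrite [isoclass Y + _]isoclass_addE !star_isoclassE -burnside_classD.
apply: burnside_class_iso; apply: gset_iso_trans (gset_iso_induced_sum _ _ _).
exact/gset_iso_induced/gset_iso_boxprod_sumr.
Qed.

Lemma star_class X Y :
  star (burnside_class X) (burnside_class Y) = burnside_class (star_gset X Y).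
Proof.
rewrite -star_isoclassE.
exact: groth_lift2_inj star_isoclassDl star_isoclassDr _ _.
Qed.

Lemma starDl x x' y : star (x + x') y = star x y + star x' y.
Proof. exact: groth_lift2Dl star_isoclassDl star_isoclassDr _ _ _. Qed.

Lemma starDr x y y' : star x (y + y') = star x y + star x y'.
Proof. exact: groth_lift2Dr star_isoclassDl star_isoclassDr _ _ _. Qed.

End Embedding.
Local Open Scope classical_set_scope.

Section SubmissiveRing.
Variable G : finGroupType.

Definition is_total_power
    (P : forall n : nat, burnside G -> burnside (wreath G n)) : Prop :=
  [/\ forall n (X : gset G),
         P n (burnside_class X) = burnside_class (gset_power n X),
      forall x, P 0%N x = 1
    & forall n x y, P n (x + y) =
        \sum_(i < n.+1) star (subnKC (leq_ord i)) (P i x) (P (n - i)%N y)].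

(* smallest is the intersection of all such B; it is itself such a B because
   the canonical basis is linearly independent. *)
Definition power_basis (P : forall n : nat, burnside G -> burnside (wreath G n))
    (n : nat) : set (burnside (wreath G n)) :=
  smallest [set B | B `<=` @canonical_basis (wreath G n) /\
                    range (P n) `<=` int_span B] set0.
Arguments power_basis : clear implicits.

Definition power_summand
    (P : forall n : nat, burnside G -> burnside (wreath G n)) (n : nat) :
  set (burnside (wreath G n)) := int_span (power_basis P n).
Arguments power_summand : clear implicits.

Definition submissive_classes (n : nat) : set (burnside (wreath G n)) :=
  [set u | exists X : gset (wreath G n), submissive X /\ u = burnside_class X].
Arguments submissive_classes : clear implicits.

Definition submissive_ring (n : nat) : set (burnside (wreath G n)) :=
  int_span (submissive_classes n).
Arguments submissive_ring : clear implicits.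

Lemma submissive_point n : submissive (gset_point (wreath G n)).
Proof.
exists unit, (fun _ x => x); split=> //.
by exists (fun _ _ => tt); split=> // -[] [].
Qed.

Lemma submissive_prod n (X Y : gset (wreath G n)) :
  submissive X -> submissive Y -> submissive (gset_prod X Y).
Proof.
move=> [U [a [[a1 aM] [f [fI fE]]]]] [V [b [[b1 bM] [g [gI gE]]]]].
exists (U * V)%type, (fun h u => (a h u.1, b h u.2)); split.
  by split=> [[u v]|h k [u v]] /=; rewrite ?(a1, b1) ?(aM, bM).
exists (fun u i => (f u.1 i, g u.2 i)); split.
  move=> [x y] [x' y'] /= h; congr (_, _).
    by apply: fI; apply/funext => i; have [] := congr1 (@^~ i) h.
  by apply: gI; apply/funext => i; have [] := congr1 (@^~ i) h.
by move=> h [x y]; apply/funext => i /=; rewrite fE gE.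
Qed.

Lemma submissive_subring n : subring_closed [pred u | u \in submissive_ring n].
Proof.
split; rewrite ?inE.
- apply: int_span_sub; exists (gset_point _); split=> //.
  exact: submissive_point.
- by move=> x y; rewrite !inE => hx hy; apply: int_spanB.
- move=> x y; rewrite !inE; apply: int_spanM => u v [X [hX ->]] [Y [hY ->]].
  exists (gset_prod X Y); split; last by rewrite burnside_classM.
  exact: submissive_prod.
Qed.

End SubmissiveRing.

Arguments power_basis {G} P n.
Arguments power_summand {G} P n.
Arguments submissive_classes G n : clear implicits.
Arguments submissive_ring G n : clear implicits.

(* Main.v *)
Require Import Defs.
From mathcomp Require Import all_boot all_fingroup classical_sets.
From mathcomp Require Import all_algebra generic_quotient boolp.

(** Write W for the wreath product of G with the symmetric group on n letters.
    Both sides turn out to be the integral span of the set T of classes of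
    transitive submissive W-sets.

    For the submissive ring this is the orbit decomposition: an orbit of a
    submissive set is submissive, because submissiveness passes to any set with
    an equivariant injection into a submissive one
    ([submissive_ring_transitive]).

    For the power summand one shows that T is the power basis itself
    ([power_basisE]), which takes two facts.

    First, the image of the power operation lies in the span of T
    ([total_power_submissive]).  On the class of a G-set X this is clear, as the
    value is the class of the n-th power of X.  For x = [X] - [Y], expanding
    P_n [X] = P_n (x + [Y]) gives
      P_n x = P_n [X] - sum over i < n of P_i x * P_(n-i) [Y],
    where * is the transfer product, and one concludes by induction on n.
    What makes the induction work is that the transfer product of two submissive
    sets is submissive ([submissive_star]): if X embeds in the i-th power of U
    and Y in the j-th power of V, then X * Y embeds in the power of the disjoint
    union of U and V, since a vector with entries of type U in the first block
    and of type V in the second remembers the blocks.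

    Secondly, any set B of basis elements whose span contains the image of P_n
    contains T.  A transitive submissive Z embeds in the n-th power of some
    finite G-set Y ([submissive_finite]), so Z is an orbit in a set whose class
    is in the span of B.  The number of points whose stabilizer is that of a
    point of Z extends to an additive function on the Burnside ring; it vanishes
    on every transitive set not isomorphic to Z, but not on the power of Y, so
    [Z] must be in B ([basis_contains_orbit]). *)

Set Implicit Arguments.
Unset Strict Implicit.
Unset Printing Implicit Defensive.

Import GRing.Theory.
Local Open Scope ring_scope.
Local Open Scope classical_set_scope.

(** * Integral spans *)

Section IntegralSpan.
Variable V : zmodType.

Lemma int_span_min (B S : set V) :
  B `<=` S -> S 0 -> (forall u v, S u -> S v -> S (u - v)) ->
  int_span B `<=` S.
Proof.
move=> BS S0 SB u [k [c [b [hb ->]]]].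
have SN v : S v -> S (- v) by move=> Sv; rewrite -sub0r; apply: SB.
have SD v w : S v -> S w -> S (v + w).
  by move=> Sv Sw; rewrite -[w]opprK; apply: SB => //; apply: SN.
have SM v m : S v -> S (v *+ m).
  by move=> Sv; elim: m => [|m IH]; rewrite ?mulr0n // mulrS; apply: SD.
elim/big_ind: _ => // i _; have Sb := BS _ (hb i).
by case: (c i) => m; [apply: SM | apply: SN; apply: SM].
Qed.

Lemma int_span_idem (B C : set V) :
  B `<=` int_span C -> int_span B `<=` int_span C.
Proof.
by move=> h; apply: int_span_min => //; [exact: int_span0 | exact: int_spanB].
Qed.

End IntegralSpan.

(** * Additive functions on a Grothendieck ring *)

Section GrothendieckAdditive.
Variables (S : comPzSemiRingType) (V : zmodType) (f : S -> V).
Hypothesis fD : forall p q, f (p + q) = f p + f q.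

Definition groth_lift (x : groth S) : V :=
  f (groth_repr x).1 - f (groth_repr x).2.

Lemma groth_liftE p q : groth_lift (groth_class (p, q)) = f p - f q.
Proof.
have [k e] := groth_repr_class (p, q); move: (congr1 f e).
rewrite !fD /= => /addIr h.
by apply/eqP; rewrite subr_eq addrAC -h addrK.
Qed.

Lemma groth_lift_inj p : groth_lift (groth_inj p) = f p.
Proof.
have f0 : f 0 = 0 by apply: (addrI (f 0)); rewrite -fD !addr0.
by rewrite groth_liftE f0 subr0.
Qed.

Lemma groth_liftB x y : groth_lift (x - y) = groth_lift x - groth_lift y.
Proof.
elim/groth_ind: x => p p'; elim/groth_ind: y => q q'.
rewrite [- _]groth_oppE [_ + _]groth_addE !groth_liftE /= !fD !opprD opprK.
by rewrite addrACA [f q' - _]addrC.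
Qed.

End GrothendieckAdditive.

(** * Orbits, stabilizers and the canonical basis *)

Section Orbits.
Variable Gam : finGroupType.
Implicit Types X Y Z : gset Gam.

(** Equality of stabilizers, without naming the subgroups; x and z may live in
    different sets. *)
Definition same_isotropy X Z (x : X) (z : Z) : bool :=
  [forall a, (gset_act a x == x) == (gset_act a z == z)].

Lemma same_isotropyP X Z (x : X) (z : Z) :
  reflect (forall a, gset_act a x = x <-> gset_act a z = z)
    (same_isotropy x z).
Proof.
apply: (iffP forallP) => h a; have := h a.
  by move/eqP => e; split=> /eqP; [rewrite e|rewrite -e] => /eqP.
by move=> [h1 h2]; apply/eqP; apply/idP/idP => /eqP; [move/h1|move/h2] => /eqP.
Qed.

Lemma same_isotropy_embed X Y Z (f : X -> Y) (x : X) (z : Z) :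
  injective f -> (forall a u, f (gset_act a u) = gset_act a (f u)) ->
  same_isotropy (f x) z = same_isotropy x z.
Proof.
by move=> fI fE; apply: eq_forallb => a; rewrite -fE (inj_eq fI).
Qed.

(** A transitive set is the coset space of a stabilizer: the map sending a x to
    a z is well defined and injective because x and z have the same
    stabilizer. *)
Lemma transitive_same_isotropy X Z (x : X) (z : Z) :
  gset_transitive X -> gset_transitive Z -> same_isotropy x z -> gset_iso X Z.
Proof.
move=> [x0 tX] [z0 tZ] /same_isotropyP h.
have {}tX y : {a | y = gset_act a x}.
  apply: cid; have [a ->] := tX y; have [b xb] := tX x.
  by exists (a * b^-1)%g; rewrite gset_actM xb gset_actK.
have {}tZ y : exists a, y = gset_act a z.
  have [a ->] := tZ y; have [b xb] := tZ z.
  by exists (a * b^-1)%g; rewrite gset_actM xb gset_actK.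
have h2 a b : gset_act a x = gset_act b x <-> gset_act a z = gset_act b z.
  have E (U : gset Gam) (u : U) :
      gset_act a u = gset_act b u <-> gset_act (b^-1 * a)%g u = u.
    rewrite gset_actM; split=> [->|e]; first by rewrite gset_actK.
    by rewrite -[RHS](congr1 (gset_act b) e) gset_actVK.
  by rewrite !E.
pose F y := gset_act (sval (tX y)) z.
have FE a : F (gset_act a x) = gset_act a z.
  by rewrite /F; case: (tX _) => b /= /esym /h2.
exists F; split.
  apply: inj_card_bij.
    move=> y y'; have [a ->] := tX y; have [b ->] := tX y'.
    by rewrite !FE => /h2.
  pose g y := gset_act (sval (cid (tZ y))) x.
  apply: (@leq_card _ _ g) => y y'; rewrite /g.
  by case: (cid _) => a /= ->; case: (cid _) => b /= -> /h2.
by move=> a y; have [b ->] := tX y; rewrite -gset_actM !FE gset_actM.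
Qed.

(** When Z is transitive, these points form the orbits isomorphic to Z.
    Counting points rather than orbits avoids constructing the set of orbits,
    and detects the presence of Z equally well. *)
Definition isotropy_count Z X : nat :=
  #|[pred x : X | [exists z : Z, same_isotropy x z]]|.

Lemma isotropy_count_iso Z X Y :
  gset_iso X Y -> isotropy_count Z X = isotropy_count Z Y.
Proof.
have le U W : gset_iso U W -> (isotropy_count Z U <= isotropy_count Z W)%N.
  move=> [f [/bij_inj fI fE]]; rewrite /isotropy_count -(card_image fI).
  apply/subset_leq_card/fintype.subsetP => y /fintype.imageP[x /existsP[z hz] ->].
  by apply/existsP; exists z; rewrite same_isotropy_embed.
by move=> h; apply/eqP; rewrite eqn_leq (le _ _ h) (le _ _ (gset_iso_sym h)).
Qed.

Lemma isotropy_count_sum Z X Y :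
  isotropy_count Z (gset_sum X Y) = (isotropy_count Z X + isotropy_count Z Y)%N.
Proof.
rewrite /isotropy_count -!sum1_card /= big_sumType /=.
by congr (_ + _)%N; apply: eq_bigl => u.
Qed.

Definition burnside_isotropy_count Z : burnside Gam -> int :=
  groth_lift (fun x => (isotropy_count Z (isoclass_repr x))%:Z).

Fact isotropy_count_additive Z (x y : isoclasses Gam) :
  (isotropy_count Z (isoclass_repr (x + y)))%:Z =
  (isotropy_count Z (isoclass_repr x))%:Z +
  (isotropy_count Z (isoclass_repr y))%:Z.
Proof.
rewrite -PoszD -isotropy_count_sum; congr Posz.
exact: isotropy_count_iso (isoclass_repr_iso _).
Qed.

Lemma burnside_isotropy_count_class Z X :
  burnside_isotropy_count Z (burnside_class X) = (isotropy_count Z X)%:Z.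
Proof.
rewrite /burnside_isotropy_count groth_lift_inj; last first.
  exact: isotropy_count_additive.
by congr Posz; exact: isotropy_count_iso (isoclass_repr_iso _).
Qed.

Lemma burnside_isotropy_countB Z u v :
  burnside_isotropy_count Z (u - v) =
  burnside_isotropy_count Z u - burnside_isotropy_count Z v.
Proof. exact: groth_liftB (isotropy_count_additive Z) u v. Qed.

(** This is the form in which the linear independence of the canonical basis is
    used: Z occurs in Y, hence in any expression of [Y] through basis elements.
    Were [Z] missing from B, counting points with the isotropy of Z would give 0
    on the whole span of B, but it is positive on Y. *)
Lemma basis_contains_orbit (B : set (burnside Gam)) Y Z (f : Z -> Y) :
  B `<=` @canonical_basis Gam -> int_span B (burnside_class Y) ->
  gset_transitive Z -> injective f ->
  (forall a z, f (gset_act a z) = gset_act a (f z)) ->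
  B (burnside_class Z).
Proof.
move=> Bcan spanY tZ fI fE; apply: contrapT => nBZ.
have count0 : int_span B `<=` [set u | burnside_isotropy_count Z u = 0].
  apply: int_span_min => /=.
  - move=> u Bu /=; have [X [tX uE]] := Bcan _ Bu; subst u.
    rewrite burnside_isotropy_count_class; congr Posz; apply: eq_card0 => x.
    apply/negbTE/existsP => -[z hz]; apply: nBZ.
    rewrite -(burnside_class_iso (transitive_same_isotropy tX tZ hz)).
    exact: Bu.
  - rewrite -burnside_class_empty burnside_isotropy_count_class.
    by congr Posz; apply: eq_card0 => -[].
  - by move=> u v /= hu hv; rewrite burnside_isotropy_countB hu hv subrr.
have := count0 _ spanY; rewrite /= burnside_isotropy_count_class.
case: tZ => z _ [] /eqP; rewrite -leqn0 leqNgt => /negP; apply.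
apply/card_gt0P; exists (f z); rewrite inE; apply/existsP; exists z.
by rewrite same_isotropy_embed //; apply/same_isotropyP.
Qed.

Section InvariantSubset.
Variables (X : gset Gam) (p : pred X).
Hypothesis pE : forall a x, p (gset_act a x) = p x.

Definition sub_gset_act a (x : {x : X | p x}) : {x : X | p x} :=
  exist _ (gset_act a (val x)) (etrans (pE a (val x)) (valP x)).

Fact sub_gset_actP : is_left_action sub_gset_act.
Proof.
by split=> [x|a b x]; apply: val_inj; rewrite /= ?gset_act1 ?gset_actM.
Qed.

Definition sub_gset : gset Gam := GSet sub_gset_actP.

End InvariantSubset.

Lemma burnside_class_split X (p : pred X)
    (pE : forall a x, p (gset_act a x) = p x)
    (qE : forall a x, predC p (gset_act a x) = predC p x) :
  burnside_class X = burnside_class (sub_gset pE) + burnside_class (sub_gset qE).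
Proof.
rewrite -burnside_classD; apply: burnside_class_iso; apply: gset_iso_sym.
pose f (u : sub_gset pE + sub_gset qE) : X :=
  match u with inl x => val x | inr x => val x end.
exists f; split; last by move=> a [x|x].
have fI : injective f.
  move=> [[x px]|[x px]] [[y py]|[y py]] /= e; subst.
  - by congr inl; apply: val_inj.
  - by case/negP: (py).
  - by case/negP: (px).
  - by congr inr; apply: val_inj.
apply: inj_card_bij => //; rewrite -(card_codom fI).
apply/subset_leq_card/fintype.subsetP => x _; apply/codomP.
case: (boolP (p x)) => px; first by exists (inl (exist _ x px)).
by exists (inr (exist _ x px)).
Qed.

(** Splitting off one orbit at a time, by induction on the cardinality.  The
    property Q stands for any condition inherited by invariant subsets. *)
Lemma burnside_class_orbits (Q : gset Gam -> Prop) X :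
  (forall Y (p : pred Y) (pE : forall a y, p (gset_act a y) = p y),
    Q Y -> Q (sub_gset pE)) ->
  Q X ->
  int_span [set u | exists Z, [/\ gset_transitive Z, Q Z &
    u = burnside_class Z]] (burnside_class X).
Proof.
move=> Qsub; have [m] := ubnP #|X|; elim: m X => // m IH X leXm QX.
have [x _|X0] := fintype.pickP (fun _ : X => true).
  pose p : pred X := fun y => [exists a, y == gset_act a x].
  have pE a y : p (gset_act a y) = p y.
    apply/existsP/existsP => -[b /eqP e].
      by exists (a^-1 * b)%g; rewrite gset_actM -e gset_actK.
    by exists (a * b)%g; rewrite gset_actM e.
  have qE a y : predC p (gset_act a y) = predC p y by rewrite /= pE.
  have px : p x by apply/existsP; exists 1%g; rewrite gset_act1.
  rewrite (burnside_class_split pE qE); apply: int_spanD.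
    apply: int_span_sub; exists (sub_gset pE); split=> //; last exact: Qsub.
    exists (exist _ x px) => -[y py]; have /existsP[a /eqP e] := py.
    by exists a; apply: val_inj.
  apply: IH; last exact: Qsub.
  rewrite -ltnS; apply: leq_trans leXm; rewrite ltnS card_sig.
  apply: proper_card.
  by apply/properP; split; [apply/fintype.subsetP | exists x; rewrite ?inE ?px].
suff -> : burnside_class X = 0 by exact: int_span0.
rewrite -(burnside_class_empty Gam); apply: burnside_class_iso.
have E (x : X) : False by have := X0 x.
exists (fun x => match E x with end); split=> [|a x]; last by case: (E x).
by exists (fun v : void => match v with end) => [x|[]]; case: (E x).
Qed.

End Orbits.

(** * Submissive sets *)

Section PowerAction.
Variables (G : finGroupType) (n : nat) (Y : Type) (act : G -> Y -> Y).
Hypothesis actP : is_left_action act.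

Lemma power_actP : is_left_action (@power_act G n Y act).
Proof.
case: actP => act1 actM.
split=> [y|a b y]; apply/funext => i; rewrite /power_act /= ffunE.
  by rewrite act1 invg1 perm1.
by rewrite actM invMg permM.
Qed.

End PowerAction.

Section Submissive.
Variable G : finGroupType.

Lemma submissive_embed n (X Y : gset (wreath G n)) (h : X -> Y) :
  injective h -> (forall a x, h (gset_act a x) = gset_act a (h x)) ->
  submissive Y -> submissive X.
Proof.
move=> hI hE [U [act [actP [f [fI fE]]]]].
exists U, act; split=> //; exists (f \o h); split; first exact: inj_comp.
by move=> a x /=; rewrite hE fE.
Qed.

Lemma submissive_power n (X : gset G) : submissive (gset_power n X).
Proof.
exists X, (@gset_act G X); split; first exact: gset_actP.
exists (fun x : {ffun 'I_n -> X} => x : 'I_n -> X); split.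
  by move=> x y e; apply/ffunP => i; rewrite e.
by move=> a x; apply/funext => i; rewrite ffunE.
Qed.

(** The entries of the vectors f x form a finite set, and it is stable under G:
    applying a to the i-th entry of f x yields the i-th entry of f (b x), where b
    is the element of the wreath product with all components a and trivial
    permutation. *)
Lemma submissive_finite n (X : gset (wreath G n)) : submissive X ->
  exists (Y : gset G) (f : X -> gset_power n Y), injective f /\
    forall a x, f (gset_act a x) = gset_act a (f x).
Proof.
move=> [U [act [[act1 actM] [f [fI fE]]]]].
(* A finite subtype needs a choice structure on U; classical logic gives one. *)
pose s : seq {classic U} := [seq f p.1 p.2 | p : (X * 'I_n)%type].
have sf x i : (f x i : {classic U}) \in s.
  by apply/fintype.imageP; exists (x, i).
have sact a (u : seq_sub s) : (act a (ssval u) : {classic U}) \in s.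
  have /fintype.imageP[[x i] _ ->] := ssvalP u.
  suff -> : act a (f x i) = f (gset_act (Wreath [ffun=> a] 1%g) x) i by [].
  by rewrite fE /power_act /= ffunE invg1 perm1.
pose yact a (u : seq_sub s) : seq_sub s := SeqSub (sact a u).
have yactP : is_left_action yact.
  by split=> [u|a b u]; apply: val_inj; rewrite /= ?act1 ?actM.
exists (GSet yactP), (fun x => [ffun i => SeqSub (sf x i)]); split.
  move=> x y /ffunP e; apply: fI; apply/funext => i.
  by have := e i; rewrite !ffunE => -[].
move=> a x; apply/ffunP => i; apply: val_inj.
by rewrite !ffunE /power_act /= ffunE fE.
Qed.

Lemma submissive_ring_transitive n :
  submissive_ring G n = int_span [set u | exists Z : gset (wreath G n),
    [/\ gset_transitive Z, submissive Z & u = burnside_class Z]].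
Proof.
apply/seteqP; split; apply: int_span_idem.
  move=> u [X [sX ->]]; apply: burnside_class_orbits => // Y p pE sY.
  pose incl (y : {y : Y | p y}) : Y := val y.
  by apply: (@submissive_embed _ (sub_gset pE) Y incl _ _ sY) => //; exact: val_inj.
by move=> u [Z [_ sZ uE]]; apply: int_span_sub; exists Z.
Qed.

End Submissive.

(** * The transfer product of submissive sets *)

Section Star.
Variables (G : finGroupType) (i j n : nat) (e : (i + j)%N = n).

Definition in_left (k : 'I_n) : bool :=
  match block_split e k with inl _ => true | inr _ => false end.

(** A permutation preserving the left block restricts to each block, which
    exhibits it as a block permutation. *)
Lemma block_perm_onto (s : 'S_n) :
  (forall k, in_left (s k) = in_left k) -> exists t u, s = block_perm e t u.
Proof.
move=> hs.
have hl x : {y | s (block_unsplit e (inl x)) = block_unsplit e (inl y)}.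
  have := hs (block_unsplit e (inl x)); rewrite /in_left block_unsplitK.
  case E: block_split => [y|y] // _; exists y.
  by rewrite -E block_splitK.
have hr x : {y | s (block_unsplit e (inr x)) = block_unsplit e (inr y)}.
  have := hs (block_unsplit e (inr x)); rewrite /in_left block_unsplitK.
  case E: block_split => [y|y] // _; exists y.
  by rewrite -E block_splitK.
have uI := can_inj (block_unsplitK e).
have tI : injective (fun x => sval (hl x)).
  move=> x x'; case: (hl x) => y /= E; case: (hl x') => y' /= E' yy.
  by move: E; rewrite yy -E' => /perm_inj/uI[].
have vI : injective (fun x => sval (hr x)).
  move=> x x'; case: (hr x) => y /= E; case: (hr x') => y' /= E' yy.
  by move: E; rewrite yy -E' => /perm_inj/uI[].
exists (perm tI), (perm vI); apply/permP => k.
rewrite permE /block_fun -{1}[k](block_splitK e).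
by case: block_split => x; rewrite permE; [case: (hl x)|case: (hr x)].
Qed.

Section BlockVector.
Variables (U V : Type) (actU : G -> U -> U) (actV : G -> V -> V).

Definition sum_fun_act a (w : U + V) : U + V :=
  match w with inl u => inl (actU a u) | inr v => inr (actV a v) end.

Definition block_vector (x : 'I_i -> U) (y : 'I_j -> V) (k : 'I_n) : U + V :=
  match block_split e k with inl l => inl (x l) | inr l => inr (y l) end.

Lemma block_vector_inj x y x' y' :
  block_vector x y = block_vector x' y' -> x = x' /\ y = y'.
Proof.
move=> E; split; apply/funext => l.
  have := congr1 (@^~ (block_unsplit e (inl l))) E.
  by rewrite /block_vector block_unsplitK => -[].
have := congr1 (@^~ (block_unsplit e (inr l))) E.
by rewrite /block_vector block_unsplitK => -[].
Qed.

Lemma block_vector_act (h : wreath G i * wreath G j) x y :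
  power_act sum_fun_act (wreath_embed e h) (block_vector x y) =
  block_vector (power_act actU h.1 x) (power_act actV h.2 y).
Proof.
apply/funext => k; rewrite /power_act /block_vector /= ffunE -block_permV.
rewrite permE /block_fun block_unsplitK.
by case: block_split.
Qed.

(** The type of an entry, U or V, tells its block.  So an element carrying one
    block vector to another preserves the blocks, and lies in the image of the
    product of the two smaller wreath products. *)
Lemma block_vector_stab (b : wreath G n) x y x' y' :
  power_act sum_fun_act b (block_vector x y) = block_vector x' y' ->
  exists h, b = wreath_embed e h.
Proof.
move=> E.
have hb k : in_left ((wperm b)^-1%g k) = in_left k.
  have := congr1 (@^~ k) E; rewrite /power_act /block_vector /in_left.
  by do 2 case: block_split => ?.
have [t [u tu]] : exists t u, wperm b = block_perm e t u.
  by apply: block_perm_onto => k; rewrite -[in RHS](permK (wperm b) k) hb.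
exists (Wreath [ffun l => wbase b (block_unsplit e (inl l))] t,
        Wreath [ffun l => wbase b (block_unsplit e (inr l))] u).
rewrite /wreath_embed /= -tu; case: b {E hb tu} => g s /=; congr Wreath.
apply/ffunP => k; rewrite ffunE -{1}[k](block_splitK e).
by case: block_split => l; rewrite ffunE.
Qed.

End BlockVector.

(** The pair (a, (x, y)) is sent to the translate by a of the block vector of x
    and y in the power of U + V.  This is well defined on the induced set because
    block vectors are equivariant for the embedded product group, and injective
    because only elements of that subgroup carry block vectors to block
    vectors. *)
Lemma submissive_star (X : gset (wreath G i)) (Y : gset (wreath G j)) :
  submissive X -> submissive Y -> submissive (star_gset e X Y).
Proof.
move=> [U [actU [actUP [f [fI fE]]]]] [V [actV [actVP [g [gI gE]]]]].
have actP : is_left_action (sum_fun_act actU actV).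
  case: actUP actVP => u1 uM [v1 vM].
  by split=> [[w|w]|a b [w|w]] /=; rewrite ?(u1, v1) ?(uM, vM).
have [pow1 powM] := power_actP n actP.
pose F (p : wreath G n * boxprod X Y) : 'I_n -> U + V :=
  power_act (sum_fun_act actU actV) p.1 (block_vector (f p.2.1) (g p.2.2)).
have FE a z h : F ((a * wreath_embed e h)%g, z) = F (a, gset_act h z).
  by rewrite /F /= powM block_vector_act fE gE.
pose F' (x : star_gset e X Y) := F (repr x).
have F'E p : F' (induced_class (wreath_embed_morphism G e) p) = F p.
  have : induced_class (wreath_embed_morphism G e)
      (repr (induced_class (wreath_embed_morphism G e) p)) =
    induced_class (wreath_embed_morphism G e) p by exact: reprK.
  rewrite /F'; case: (repr _) => a z; case: p => b w.
  by move/induced_classP => [h /= [-> ->]]; rewrite FE.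
exists (U + V)%type, (sum_fun_act actU actV); split=> //.
exists F'; split; last first.
  move=> a; elim/induced_ind => b z.
  by rewrite /= induced_actE !F'E /F /= powM.
elim/induced_ind => a [x y]; elim/induced_ind => b [x' y'].
rewrite !F'E /F /= => E.
have {}E : power_act (sum_fun_act actU actV) (b^-1 * a)%g
    (block_vector (f x) (g y)) = block_vector (f x') (g y').
  by rewrite powM E -powM mulVg pow1.
have [h hE] := block_vector_stab E; move: E.
rewrite hE block_vector_act -fE -gE => /block_vector_inj[/fI xx /gI yy].
apply/induced_classP; exists h; split; first by rewrite /= -hE mulKVg.
by rewrite /= /boxprod_act /= xx yy.
Qed.

Lemma starBl x x' (y : burnside (wreath G j)) :
  star e (x - x') y = star e x y - star e x' y.
Proof. by apply/eqP; rewrite eq_sym subr_eq -starDl subrK. Qed.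

Lemma starBr (x : burnside (wreath G i)) y y' :
  star e x (y - y') = star e x y - star e x y'.
Proof. by apply/eqP; rewrite eq_sym subr_eq -starDr subrK. Qed.

Lemma submissive_ring_star x y :
  submissive_ring G i x -> submissive_ring G j y ->
  submissive_ring G n (star e x y).
Proof.
move=> hx hy; apply: (@int_span_min _ _
  [set x | submissive_ring G n (star e x y)] _ _ _ x hx) => /=.
- move=> _ [X [sX ->]] /=; apply: (@int_span_min _ _
    [set y | submissive_ring G n (star e (burnside_class X) y)] _ _ _ y hy).
  + move=> _ [Y [sY ->]] /=; rewrite star_class; apply: int_span_sub.
    by exists (star_gset e X Y); split=> //; apply: submissive_star.
  + by rewrite /= -(subrr 0) starBr subrr; apply: int_span0.
  + by move=> u v hu hv /=; rewrite starBr; apply: int_spanB.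
- by rewrite -(subrr 0) starBl subrr; apply: int_span0.
- by move=> u v hu hv /=; rewrite starBl; apply: int_spanB.
Qed.

End Star.

(** The hypothesis e forces m = 0; it is stated for a variable m because the top
    term of the addition formula for power operations has n - n there.  As the
    wreath product on no letters is trivial, the embedding is then an
    isomorphism, and inducing along it changes nothing. *)
Lemma star_unit (G : finGroupType) (n m : nat) (e : (n + m)%N = n) x :
  star e x (1 : burnside (wreath G m)) = x.
Proof.
have m0 : m = 0%N by apply/eqP; rewrite -(eqn_add2l n) e addn0.
subst m.
have splitE k : block_split e k = inl k.
  rewrite -[RHS](block_unsplitK e); congr block_split.
  by apply: val_inj.
have embedE h : wreath_embed e h = h.1.
  case: h => [[f s] h]; rewrite /wreath_embed /=; congr Wreath.
    by apply/ffunP => k; rewrite ffunE splitE.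
  apply/permP => k; rewrite permE /block_fun splitE.
  by apply: val_inj.
have [X [Y ->]] := burnside_classB x.
rewrite starBl -burnside_class_point !star_class.
suff unit_iso Z : gset_iso Z (star_gset e Z (gset_point (wreath G 0))).
  by rewrite -!(burnside_class_iso (unit_iso _)).
pose cls := @induced_class _ _ (wreath_embed_morphism G e)
  (boxprod Z (gset_point (wreath G 0))).
have clsE a z : cls (a, (z, tt)) = cls (1%g, (gset_act a z, tt)).
  by apply/induced_classP; exists (a, 1%g); rewrite /= embedE mul1g.
exists (fun z => cls (1%g, (z, tt))); split; last first.
  by move=> a z; rewrite /= induced_actE /= mulg1 -clsE.
have clsI : injective (fun z => cls (1%g, (z, tt))).
  move=> z z' /induced_classP[h /=].
  rewrite embedE mul1g => -[h1 [->]].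
  by rewrite -h1 gset_act1.
pose g (u : star_gset e Z (gset_point (wreath G 0))) : Z :=
  gset_act (repr u).1 (repr u).2.1.
exists g.
  move=> z; apply: clsI; rewrite /g -clsE.
  rewrite -[RHS]reprK -/(cls _); congr cls.
  by case: (repr _) => a [z' []].
move=> u; rewrite /g -clsE -[RHS]reprK -/(cls _); congr cls.
by case: (repr _) => a [z' []].
Qed.

(** * Power operations and their basis *)

(** Since 1 is the unit of the transfer product, the term i = n of the addition
    formula for x + [Y] = [X] is P_n x itself; all the others have i < n, so
    the induction hypothesis covers them. *)
Lemma total_power_submissive (G : finGroupType)
    (P : forall m : nat, burnside G -> burnside (wreath G m))
    (hP : is_total_power P) n x :
  submissive_ring G n (P n x).
Proof.
case: hP => Pclass P0 PD.
have Psub m X : submissive_ring G m (P m (burnside_class X)).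
  rewrite Pclass; apply: int_span_sub; exists (gset_power m X); split=> //.
  exact: submissive_power.
have P0' m y : m = 0%N -> P m y = 1 by move=> ->.
elim/ltn_ind: n => n IH; have [X [Y xE]] := burnside_classB x.
have := PD n x (burnside_class Y).
rewrite {1}xE subrK big_ord_recr /= (P0' _ _ (subnn n)) star_unit addrC.
move/eqP; rewrite -subr_eq => /eqP <-.
apply: int_spanB; [exact: Psub | apply: int_span_sum => k].
by apply: submissive_ring_star; [exact: IH | exact: Psub].
Qed.

(** The set on the right is admissible in the definition of the power basis, and
    every admissible set contains it. *)
Lemma power_basisE (G : finGroupType) (n : nat)
    (P : forall m : nat, burnside G -> burnside (wreath G m))
    (hP : is_total_power P) :
  power_basis P n = [set u | exists Z : gset (wreath G n),
    [/\ gset_transitive Z, submissive Z & u = burnside_class Z]].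
Proof.
apply/seteqP; split=> [u|u [Z [tZ sZ ->]] B [[Bcan PB] _]].
  apply; split=> //; split; first by move=> v [Z [tZ _ ->]]; exists Z.
  by move=> _ [x _ <-]; rewrite -submissive_ring_transitive;
    apply: total_power_submissive.
have [Y [f [fI fE]]] := submissive_finite sZ.
apply: (basis_contains_orbit Bcan _ tZ fI fE).
by apply: PB; exists (burnside_class Y) => //; case: hP.
Qed.

Theorem proposition3p3 (G : finGroupType) (n : nat)
    (P : forall m : nat, burnside G -> burnside (wreath G m))
    (hP : is_total_power P) :
  submissive_ring G n = power_summand P n.
Proof.
by rewrite submissive_ring_transitive /power_summand power_basisE.
Qed.
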